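(* Fix a real number $\alpha$ with $0<\alpha<1$, and let $d\ge 4$ be an integer. For every connected unicyclic graph $G$ on $d+2$ vertices with diameter $d$ we have $SO_{\alpha}(G)\le SO_{\alpha}(U(d+2,d))$, with equality if and only if $G\cong U(d+2,d)$.
   Context: All graphs are finite and simple; $d_G(v)$ denotes the degree of a vertex $v$ in $G$. The general Sombor index is $SO_{\alpha}(G)=\sum_{uv\in E(G)}\left(d_G(u)^2+d_G(v)^2\right)^{\alpha}$. A unicyclic graph is a connected graph containing exactly one cycle. For integers $4\le d\le n-2$, $U(n,d)$ is the graph consisting of a path $v_1v_2\cdots v_d$, one extra vertex $u_0$ adjacent to exactly $v_1$ and $v_3$ (so that $v_1v_2v_3u_0v_1$ is a $4$-cycle), and $n-d-1$ further pendant vertices (vertices of degree one) each adjacent to $v_1$. In particular $U(d+2,d)$ has exactly one pendant vertex attached to $v_1$. *)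

(* Defs.v *)
From mathcomp Require Import all_boot all_order all_algebra.
From mathcomp Require Import reals exp.

Set Implicit Arguments.
Unset Strict Implicit.
Unset Printing Implicit Defensive.

Import Order.TTheory GRing.Theory Num.Theory.

Record sgraph := SGraph {
  vertex :> finType;
  adj : rel vertex;
  adj_sym : symmetric adj;
  adj_irrefl : irreflexive adj }.

Section Invariants.
Variable G : sgraph.
Implicit Types (x y : G) (c : seq G).

Definition degree x : nat := #|[set y | adj x y]|.

Definition edges : {set {set G}} :=
  [set [set p.1; p.2] | p : G * G & adj p.1 p.2].

Definition graph_connected : Prop :=
  (0 < #|G|)%N /\ forall x y, connect (@adj G) x y.

Definition walk_of_length (k : nat) x y : bool :=
  [exists p : k.-tuple G, path (@adj G) x p && (last x p == y)].

(* A shortest walk visits each vertex at most once, so its length is < #|G|;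
   #|G| is the default value when no walk from x to y exists. *)
Definition dist x y : nat :=
  \big[minn/#|G|]_(k < #|G| | walk_of_length k x y) k.

Definition diameter : nat := \max_(x : G) \max_(y : G) dist x y.

Definition cycle_edges c : {set {set G}} := [set [set x; next c x] | x in c].

(* A cycle is a subgraph, identified with its edge set, so that rotations and
   reversals of a cyclic vertex sequence are the same cycle. *)
Definition is_cycle (A : {set {set G}}) : Prop :=
  exists c, [/\ (2 < size c)%N, ucycle (@adj G) c & A = cycle_edges c].

Definition unicyclic : Prop := graph_connected /\ exists! A, is_cycle A.

End Invariants.

Definition isomorphic (G H : sgraph) : Prop :=
  exists f : G -> H, bijective f /\ forall x y, adj (f x) (f y) = adj x y.

(* For an edge A = {u, v} the inner sum is d(u)^2 + d(v)^2. *)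
Definition sombor (R : realType) (alpha : R) (G : sgraph) : R :=
  (\sum_(A in edges G) ((\sum_(x in A) degree x ^ 2)%N%:R `^ alpha))%R.

(* U(n, d) on 'I_n, for 4 <= d <= n - 2: index i < d is the path vertex v_(i+1),
   index d is u_0, and the indices d < i < n are the n - d - 1 pendant
   neighbours of v_1. *)
Section UGraph.
Variables n d : nat.

Definition U_arc (i j : nat) : bool :=
  (i < j) && [|| (j < d) && (j == i.+1),
                 (j == d) && ((i == 0) || (i == 2)) |
                 (d < j) && (i == 0)].

Definition U_adj : rel 'I_n := fun i j => U_arc i j || U_arc j i.

Lemma U_adj_sym : symmetric U_adj.
Proof. by move=> i j; rewrite /U_adj orbC. Qed.

Lemma U_adj_irrefl : irreflexive U_adj.
Proof. by move=> i; rewrite /U_adj /U_arc ltnn. Qed.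

Definition U : sgraph := SGraph U_adj_sym U_adj_irrefl.

End UGraph.

(* Main.v *)
(** A diametral path v_0 ... v_d leaves exactly one further vertex w. As the path
    is a geodesic, it is induced and the neighbours of w on it lie within distance
    two; uniqueness of the cycle forces w to have exactly two of them, v_i and v_j
    with j = i + 1 or j = i + 2. The index of such a graph depends only on j - i
    and on the lengths i and d - j of the two arms. The extremal case j - i = 2
    with an arm of length one is U(d + 2, d), up to reversal of the path. Comparing
    it with the others amounts, besides monotonicity, to the concavity inequalities
    8^a + 18^a < 2 13^a, 5^a + 18^a < 10^a + 13^a and 5^a + 13^a < 8^a + 10^a. *)

Require Import Defs.
From mathcomp Require Import all_boot all_order all_algebra.
From mathcomp Require Import zify ring lra.
From mathcomp Require Import reals topology normedtype derive exp.

Import Order.TTheory GRing.Theory Num.Theory.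
Import numFieldNormedType.Exports.
Local Open Scope ring_scope.

Set Implicit Arguments.
Unset Strict Implicit.
Unset Printing Implicit Defensive.

(** * Strict concavity of the power function *)

(** The intervals [a, b] and [c, e] have equal length, so by the mean value theorem the two
    increments compare as the derivatives at some u < b <= c < v do, and [alpha * z ^ (alpha - 1)]
    is strictly decreasing. The case b = c is allowed, as 8 + 18 = 13 + 13 requires. *)
Lemma powR_strictly_concave (R : realType) (alpha a b c e : R) :
  0 < alpha -> alpha < 1 -> 0 < a -> a < b -> b <= c -> a + e = b + c ->
  a `^ alpha + e `^ alpha < b `^ alpha + c `^ alpha.
Proof.
move=> al0 al1 a0 ab bc sumE.
have slope x y : 0 < x -> x < y -> exists2 z, x < z < y &
    y `^ alpha - x `^ alpha = alpha * z `^ (alpha - 1) * (y - x).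
  move=> x0 xy; have drv z : x <= z ->
      is_derive z 1 (@powR R ^~ alpha) (alpha * z `^ (alpha - 1)).
    by move=> xz; apply: is_derive1_powR; apply: lt_le_trans xz.
  have [z|z|z] := @MVT R (@powR R ^~ alpha) (fun z => alpha * z `^ (alpha - 1)) x y xy.
  - by rewrite in_itv /= => /andP[/ltW xz _]; exact: drv.
  - apply: continuous_in_subspaceT => {}z /classical_sets.set_mem.
    rewrite /= in_itv /= => /andP[xz _].
    by have [df _] := drv _ xz; apply: differentiable_continuous; apply/derivable1_diffP.
  - by rewrite in_itv /= => xzy zE; exists z.
have b0 : 0 < b by lra.
have c0 : 0 < c by lra.
have [u /andP[au ub] uE] := slope a b a0 ab.
have [v /andP[cv ve] vE] : exists2 z, c < z < e &
    e `^ alpha - c `^ alpha = alpha * z `^ (alpha - 1) * (e - c).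
  by apply: slope => //; lra.
have decr : v `^ (alpha - 1) < u `^ (alpha - 1).
  have -> : alpha - 1 = - (1 - alpha) by ring.
  rewrite !powRN ltf_pV2 ?posrE ?powR_gt0; try lra.
  by apply: gt0_ltr_powR; rewrite ?nnegrE; lra.
have eE : e - c = b - a by lra.
have : alpha * v `^ (alpha - 1) * (e - c) < alpha * u `^ (alpha - 1) * (b - a).
  by rewrite eE ltr_pM2r ?ltr_pM2l //; lra.
lra.
Qed.

(** * Isomorphism, and the index as a sum over arcs *)

Lemma isomorphic_sym (G H : sgraph) : isomorphic G H -> isomorphic H G.
Proof.
case=> f [[g fK gK] fadj]; exists g; split; first by exists f.
by move=> x y; rewrite -fadj !gK.
Qed.

Lemma isomorphic_trans (G H K : sgraph) :
  isomorphic G H -> isomorphic H K -> isomorphic G K.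
Proof.
case=> f [fbij fadj] [g [gbij gadj]]; exists (g \o f).
by split; [exact: bij_comp | move=> x y; rewrite /= gadj fadj].
Qed.

Lemma sombor_isomorphic (R : realType) (alpha : R) (G H : sgraph) :
  isomorphic G H -> sombor alpha G = sombor alpha H.
Proof.
case=> f [fbij fadj]; have finj := bij_inj fbij.
have fdeg x : degree (f x) = degree x.
  rewrite /degree -(card_imset _ finj); apply: eq_card => y; rewrite inE.
  by have [g fK gK] := fbij; rewrite -[y]gK mem_imset // inE fadj.
have fedges : edges H = [set f @: A | A : {set G} in edges G].
  apply/setP => B; apply/imsetP/imsetP => [[[x y] xy ->] | [A /imsetP[[x y] xy ->] ->]].
    have [g fK gK] := fbij; exists [set g x; g y].
      by apply/imsetP; exists (g x, g y) => //; move: xy; rewrite !inE /= -fadj !gK.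
    by rewrite imsetU1 imset_set1 !gK.
  exists (f x, f y); last by rewrite imsetU1 imset_set1.
  by move: xy; rewrite !inE /= fadj.
rewrite [RHS]/sombor fedges [RHS]big_imset /=; last by move=> A B _ _; exact: imset_inj.
apply: eq_bigr => A _; congr (_%:R `^ _).
rewrite big_imset /=; last by move=> x y _ _; exact: finj.
by apply: eq_bigr => x _; rewrite fdeg.
Qed.

Definition edge_weight (R : realType) (alpha : R) (a b : nat) : R :=
  (a ^ 2 + b ^ 2)%N%:R `^ alpha.

Lemma edge_weightC (R : realType) (alpha : R) a b :
  edge_weight alpha a b = edge_weight alpha b a.
Proof. by rewrite /edge_weight addnC. Qed.

(** Sending an arc to its edge is onto because [arc] covers [adj], and injective because [arc] is
    asymmetric; this trades two-element sets for ordered pairs, grouped by the head y. *)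
Lemma sombor_orientation (R : realType) (alpha : R) (G : sgraph) (arc : rel G) :
  (forall x y, adj x y = arc x y || arc y x) ->
  (forall x y, arc x y -> ~~ arc y x) ->
  sombor alpha G = \sum_y \sum_(x | arc x y)
    edge_weight alpha (degree x) (degree y).
Proof.
move=> adjE asym.
have edgesE : edges G = [set [set p.2; p.1] | p : G * G & arc p.2 p.1].
  apply/setP => B; apply/imsetP/imsetP => -[[x y]]; rewrite !inE /= => xy ->.
    move: xy; rewrite adjE => /orP[xy|yx]; first by exists (y, x); rewrite ?inE.
    by exists (x, y); rewrite ?inE //= setUC.
  by exists (y, x); rewrite ?inE /= ?adjE ?xy.
rewrite /sombor edgesE big_imset /=; last first.
  move=> [x y] [x' y']; rewrite !inE /= => yx yx' E.
  have ne u v : arc u v -> u != v.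
    by move=> uv; apply: contraTneq uv => ->; apply/negP => vv; have := asym _ _ vv; rewrite vv.
  have := set21 y x; rewrite E !inE => /orP[/eqP y1|/eqP y1].
    have := set22 y x; rewrite E !inE => /orP[/eqP x1|/eqP x1]; last by rewrite x1 y1.
    by have := ne _ _ yx; rewrite x1 y1 eqxx.
  have := set22 y x; rewrite E !inE => /orP[/eqP x1|/eqP x1].
    by have := asym _ _ yx; rewrite x1 y1 yx'.
  by have := ne _ _ yx; rewrite x1 y1 eqxx.
rewrite pair_big_dep /=; apply: eq_big => [[x y]|[x y]]; rewrite !inE //= => yx.
rewrite /edge_weight big_setU1 ?big_set1 // inE.
by apply: contraTneq yx => ->; apply/negP => xx; have := asym _ _ xx; rewrite xx.
Qed.

(** * Paths with one extra vertex attached to two of their vertices *)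

Section EaredPath.
Variables d i j : nat.

(* The indices 0, ..., d form the path, and d + 1 is the vertex w attached to i, j. *)
Definition ear_arc (a b : nat) : bool :=
  (a < b)%N && ((b <= d)%N && (b == a.+1) || (b == d.+1) && ((a == i) || (a == j))).

Lemma ear_arc_path a b : (b <= d)%N -> ear_arc a b = (b == a.+1).
Proof. by move=> bd; rewrite /ear_arc; lia. Qed.

Lemma ear_arc_ear a : (i <= d)%N -> (j <= d)%N ->
  ear_arc a d.+1 = (a == i) || (a == j).
Proof. by move=> id jd; rewrite /ear_arc ltnn eqxx /=; lia. Qed.

Definition ear_adj : rel 'I_(d + 2) := fun a b => ear_arc a b || ear_arc b a.

Lemma ear_adj_sym : symmetric ear_adj.
Proof. by move=> a b; rewrite /ear_adj orbC. Qed.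

Lemma ear_adj_irrefl : irreflexive ear_adj.
Proof. by move=> a; rewrite /ear_adj /ear_arc ltnn. Qed.

Definition eared_path : sgraph := SGraph ear_adj_sym ear_adj_irrefl.

(** Defined on all naturals, so that sums over path edges can be split and reindexed without
    ordinals. *)
Definition ear_degree (a : nat) : nat :=
  (if a == d.+1 then 2 else (0 < a) + (a < d) + ((a == i) || (a == j)))%N.

Lemma ear_degreeE a : (a <= d)%N ->
  ear_degree a = ((0 < a) + (a < d) + ((a == i) || (a == j)))%N.
Proof. by move=> ad; rewrite /ear_degree; case: eqP => //; lia. Qed.

Lemma sum_ord_eq (n c : nat) : (\sum_(b < n) (b == c :> nat) = (c < n))%N.
Proof.
rewrite -(big_mkord xpredT (fun b => nat_of_bool (b == c))).
elim: n => [|n IHn]; first by rewrite big_geq.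
by rewrite big_nat_recr //= IHn; case: (ltngtP n c) => ? ; lia.
Qed.

Lemma degree_eared_path (a : eared_path) : (i < j <= d)%N -> degree a = ear_degree a.
Proof.
move=> ij; rewrite /degree cardsE -sum1_card big_mkcond /=.
have ad := ltn_ord a.
(* Adjacency to a is a sum of indicators of single vertices: right and left path neighbours, the
   vertex w, and i and j when a is w. The guard [0 < a <= d] matters, as [a.-1] is a itself for a =
   0 and is d for w. *)
transitivity (\sum_(b < d + 2) ((a < d) * (b == a.+1 :> nat) +
    ((0 < a <= d) * (b == a.-1 :> nat) +
    (((a == i :> nat) || (a == j :> nat)) * (b == d.+1 :> nat) +
    ((a == d.+1 :> nat) * (b == i :> nat) +
     (a == d.+1 :> nat) * (b == j :> nat))))))%N.
  apply: eq_bigr => b _; have bd := ltn_ord b.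
  rewrite -topredE /= /ear_adj /ear_arc.
  rewrite !mulnb -[if _ then _ else _]/(nat_of_bool _).
  have [a_le|a_gt] := leqP a d; have [b_le|b_gt] := leqP b d.
  - have -> : (a == d.+1 :> nat) = false by lia.
    have -> : (b == d.+1 :> nat) = false by lia.
    rewrite !andbF !andFb !orbF !addn0.
    by case: (ltngtP b a) => ?; lia.
  - have -> : (a == d.+1 :> nat) = false by lia.
    have -> : (b == d.+1 :> nat) by lia.
    by case: ((a == i :> nat) || _); lia.
  - have -> : (a == d.+1 :> nat) by lia.
    have -> : (b == d.+1 :> nat) = false by lia.
    by lia.
  - have -> : (a == d.+1 :> nat) by lia.
    have -> : (b == d.+1 :> nat) by lia.
    by lia.
rewrite !big_split /= -!big_distrr /= !sum_ord_eq /ear_degree.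
have -> : (i < d + 2)%N by lia.
have -> : (j < d + 2)%N by lia.
have -> : (d.+1 < d + 2)%N by lia.
have -> : (a.-1 < d + 2)%N by lia.
case: (eqVneq (a : nat) d.+1) => [aE|aN].
  by rewrite !aE; have -> : (d.+1 == i) || (d.+1 == j) = false; lia.
have -> : (a <= d)%N by lia.
have -> : (a.+1 < d + 2)%N by lia.
by case: (_ || _); lia.
Qed.

Variables (R : realType) (alpha : R).
Local Notation W := (edge_weight alpha).

(** Arcs point to the larger index: none ends at 0, exactly one ends at each of 1, ..., d, and w
    receives the two from i and j. *)
Lemma sombor_eared_path : (i < j <= d)%N ->
  sombor alpha eared_path = \sum_(0 <= k < d) W (ear_degree k) (ear_degree k.+1)
    + W (ear_degree i) 2 + W (ear_degree j) 2.
Proof.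
move=> ijd; rewrite (@sombor_orientation _ _ eared_path ear_arc) //; last first.
  by move=> a b; rewrite /ear_arc; lia.
pose F a b := W (ear_degree a) (ear_degree b).
transitivity (\sum_(0 <= b < d.+2) \sum_(0 <= a < d.+2 | ear_arc a b) F a b).
  rewrite -[d.+2]addn2 big_mkord; apply: eq_bigr => b _; rewrite big_mkord.
  by apply: eq_bigr => a _; rewrite !degree_eared_path.
have col1 b c : (forall a, ear_arc a b = (a == c)) -> (c < d.+2)%N ->
    \sum_(0 <= a < d.+2 | ear_arc a b) F a b = F c b.
  by move=> arcE cd; rewrite (eq_bigl _ _ arcE) big_nat1_eq cd.
rewrite big_nat_recr //= big_nat_recl //= big1 ?add0r; last first.
  by move=> a; rewrite /ear_arc ltn0.
rewrite -addrA; congr (_ + _).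
  apply: eq_big_nat => k kd; rewrite (col1 _ k) //; last by lia.
  by move=> a; rewrite /ear_arc; lia.
have degD : ear_degree d.+1 = 2 by rewrite /ear_degree eqxx.
rewrite (bigID (pred1 i)) /=; congr (_ + _).
  rewrite (eq_bigl (pred1 i)) => [|a]; last by rewrite /ear_arc /=; lia.
  by rewrite big_nat1_eq /F degD; have -> : (0 <= i < d.+2)%N by lia.
rewrite (eq_bigl (pred1 j)) => [|a]; last by rewrite /ear_arc /=; lia.
by rewrite big_nat1_eq /F degD; have -> : (0 <= j < d.+2)%N by lia.
Qed.

End EaredPath.

(** * The index in terms of the two arm lengths *)

Section Values.
Variables (R : realType) (alpha : R).
Local Notation W := (edge_weight alpha).

(** Total weight of a pendant path with a edges hanging from a vertex of degree 3. It is affine in a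
    only from a = 2 on. *)
Definition arm_weight (a : nat) : R :=
  match a with
  | 0 => 0
  | 1 => W 1 3
  | a.+2 => W 1 2 + W 2 3 + a%:R * W 2 2
  end.

(** The degree sequence [g], read from the leaf to the root, is kept abstract so that it fits both
    arms. An empty arm puts no condition on the root, whose degree is then 2. *)
Lemma sum_arm (g : nat -> nat) a :
  ((0 < a)%N -> g 0 = 1%N /\ g a = 3%N) ->
  (forall k, (0 < k < a)%N -> g k = 2%N) ->
  \sum_(0 <= k < a) W (g k) (g k.+1) = arm_weight a.
Proof.
case: a => [|[|a]] gE g2; first by rewrite big_geq.
  by have [|g0 g1] := gE; rewrite // big_nat1 g0 g1.
have [|g0 ga] := gE; first by [].
have ga1 : g a.+1 = 2%N by apply: g2; lia.
rewrite big_nat_recl // big_nat_recr //= g0 ga ga1 (g2 1%N) //.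
rewrite (eq_big_nat _ _ (F2 := fun=> W 2 2)) => [|k ka]; last by rewrite !g2 //; lia.
by rewrite sumr_const_nat subn0 -mulr_natl; ring.
Qed.

(** Degree of the vertex where an arm of length a meets the cycle: two cycle edges, and one arm edge
    if the arm is nonempty. *)
Definition root_degree (a : nat) : nat := 2 + (0 < a).

Lemma sombor_eared_path_arms d i j : (i < j <= d)%N ->
  sombor alpha (eared_path d i j) =
    arm_weight i + arm_weight (d - j)
    + \sum_(i <= k < j) W (ear_degree d i j k) (ear_degree d i j k.+1)
    + W (root_degree i) 2 + W (root_degree (d - j)) 2.
Proof.
move=> ijd; rewrite sombor_eared_path //; set D := ear_degree d i j.
have Di : D i = root_degree i by rewrite /D ear_degreeE ?eqxx /root_degree; lia.
have Dj : D j = root_degree (d - j) by rewrite /D ear_degreeE ?eqxx ?orbT /root_degree; lia.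
rewrite Di Dj (big_cat_nat (n := i)) //=; last by lia.
rewrite (big_cat_nat (m := i) (n := j)) //=; [|lia|lia].
rewrite (@sum_arm D i); first last.
- by move=> k ki; rewrite /D ear_degreeE; lia.
- by move=> i0; rewrite Di /root_degree /D ear_degreeE; lia.
(* The right arm is read backwards, from its leaf d to its root j. *)
have -> : \sum_(j <= k < d) W (D k) (D k.+1) = arm_weight (d - j).
  rewrite -(@sum_arm (fun k => D (d - k)%N)); first last.
  - by move=> k kj; rewrite /D ear_degreeE; lia.
  - move=> j0; rewrite subKn ?Dj /root_degree; last by lia.
    by rewrite /D ear_degreeE; lia.
  rewrite big_nat_rev -{1}[j]add0n big_addn.
  apply: eq_big_nat => k kj; rewrite edge_weightC.
  by congr (W (D _) (D _)); lia.
by ring.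
Qed.

Lemma sombor_triangle a b :
  sombor alpha (eared_path (a + b + 1) a (a + 1)) =
    arm_weight a + arm_weight b + W (root_degree a) (root_degree b)
    + W (root_degree a) 2 + W (root_degree b) 2.
Proof.
rewrite sombor_eared_path_arms; last by lia.
have -> : (a + b + 1 - (a + 1) = b)%N by lia.
rewrite addn1 big_nat1; congr (_ + W _ _ + _ + _);
  by rewrite ear_degreeE /root_degree; lia.
Qed.

(** The path vertex between the two roots has degree 2, just like w, so each root carries two cycle
    edges of the same weight. *)
Lemma sombor_square a b :
  sombor alpha (eared_path (a + b + 2) a (a + 2)) =
    arm_weight a + arm_weight b + 2 * W (root_degree a) 2 + 2 * W (root_degree b) 2.
Proof.
rewrite sombor_eared_path_arms; last by lia.
have -> : (a + b + 2 - (a + 2) = b)%N by lia.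
rewrite addn2 big_nat_recr // big_nat1 /=.
have -> : ear_degree (a + b + 2) a a.+2 a = root_degree a by rewrite ear_degreeE /root_degree; lia.
have -> : ear_degree (a + b + 2) a a.+2 a.+1 = 2%N by rewrite ear_degreeE; lia.
have -> : ear_degree (a + b + 2) a a.+2 a.+2 = root_degree b
  by rewrite ear_degreeE /root_degree; lia.
rewrite (edge_weightC _ 2); ring.
Qed.

(** * Comparison with the extremal arm lengths *)

Hypotheses (alpha_gt0 : 0 < alpha) (alpha_lt1 : alpha < 1).

Lemma edge_weight_lt a b a' b' : (a ^ 2 + b ^ 2 < a' ^ 2 + b' ^ 2)%N -> W a b < W a' b'.
Proof.
by move=> lt_ab; apply: gt0_ltr_powR; rewrite ?nnegrE ?ler0n ?ltr_nat.
Qed.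

(** The sums of squares involved are 5, 8, 10, 13 and 18; the last three inequalities rest on 8 + 18
    = 13 + 13, 5 + 18 = 10 + 13 and 5 + 13 = 8 + 10. *)
Lemma edge_weight_ineqs :
  [/\ W 1 2 < W 2 2, W 2 2 < W 1 3 & W 1 3 < W 2 3] /\
  [/\ W 2 2 + W 3 3 < W 2 3 + W 2 3, W 1 2 + W 3 3 < W 1 3 + W 2 3
     & W 1 2 + W 2 3 < W 2 2 + W 1 3].
Proof.
split; split; try exact: edge_weight_lt.
all: by apply: powR_strictly_concave; rewrite // ?ltr0n ?ltr_nat ?ler_nat // -!natrD.
Qed.

(** If both arms have length at least 2, the difference is [W 1 3 + W 2 3 - W 1 2 - W 3 3]; for
    lengths 1 and at least 3 it is [2 * W 2 3 - W 2 2 - W 3 3]. With an empty arm monotonicity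
    suffices. *)
Lemma sombor_triangle_lt a b : (3 <= a + b)%N ->
  sombor alpha (eared_path (a + b + 1) a (a + 1)) <
  sombor alpha (eared_path (1 + (a + b - 2) + 2) 1 (1 + 2)).
Proof.
move=> ab; rewrite sombor_triangle sombor_square.
have [[W12 W22 W13] [C1 C2 C3]] := edge_weight_ineqs.
have W32 := edge_weightC alpha 3 2.
(* Lengths are split far enough for [a + b - 2] to compute to 1 or to fall in the affine range of
   [arm_weight]. *)
move: ab; case: a => [|[|[|[|a]]]]; case: b => [|[|[|[|b]]]] //.
all: rewrite /arm_weight /root_degree ?(addnS, addSn, add0n, addn0, subSS, subn0) /= => _.
all: rewrite W32; lra.
Qed.

(** Two arms of length at least 2 leave the difference [W 2 2 + W 1 3 - W 1 2 - W 2 3]; an empty arm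
    is again settled by monotonicity. *)
Lemma sombor_square_lt a b : (2 <= a + b)%N -> a != 1%N -> b != 1%N ->
  sombor alpha (eared_path (a + b + 2) a (a + 2)) <
  sombor alpha (eared_path (1 + (a + b - 1) + 2) 1 (1 + 2)).
Proof.
move=> ab; rewrite !sombor_square.
have [[W12 W22 W13] [C1 C2 C3]] := edge_weight_ineqs.
have W32 := edge_weightC alpha 3 2.
move: ab; case: a => [|[|[|a]]]; case: b => [|[|[|b]]] //.
all: rewrite /arm_weight /root_degree ?(addnS, addSn, add0n, addn0, subSS, subn0) /= => _ _ _.
all: rewrite W32; lra.
Qed.

End Values.

(** * Cycles, distances and geodesics *)

(** Once the cycle is rotated to start at x, its second and last vertices serve; they differ as the
    length exceeds 2. *)
Lemma cycle_two_neighbours (G : sgraph) (c : seq G) (x : G) :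
  (2 < size c)%N -> ucycle (@adj G) c -> x \in c ->
  exists y z, [/\ y \in c, z \in c, y != z, adj x y & adj x z].
Proof.
move=> c_size c_cyc /rot_to[n q cE].
have cm u : (u \in c) = (u \in x :: q) by rewrite -cE mem_rot.
move: c_cyc; rewrite -(rot_ucycle n) cE => /andP[].
move: c_size; rewrite -(size_rot n) cE /=.
case: q cE cm => // y q; case/lastP: q => // q z _ cm _.
rewrite /= rcons_path last_rcons => /and3P[xy _ zx] /and3P[_ yz _].
exists y, z; rewrite !cm !inE !mem_rcons !mem_head eqxx ?orbT; split=> //.
  by apply: contraNneq yz => ->; rewrite mem_rcons mem_head.
by rewrite adj_sym.
Qed.

(** Serves to tell whether [dist] is an attained minimum or its default value. *)
Lemma bigminnP (I : eqType) (r : seq I) (P : pred I) (F : I -> nat) (n : nat) :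
  let m := \big[minn/n]_(k <- r | P k) F k in
  (forall k, k \in r -> P k -> (m <= F k)%N) /\
  (m = n \/ exists2 k, P k & m = F k).
Proof.
elim: r => [|k r [IHle IHeq]] /=; first by rewrite big_nil; split; [|left].
rewrite big_cons; case: (boolP (P k)) => Pk; last first.
  split=> // l; rewrite inE => /orP[/eqP->|]; last exact: IHle.
  by rewrite (negPf Pk).
split=> [l|].
  rewrite inE => /orP[/eqP->|lr Pl]; first by rewrite geq_minl.
  by rewrite geq_min IHle ?orbT.
by case: leqP => _; [right; exists k | exact: IHeq].
Qed.

(** The hypothesis excludes the default value of [dist], so the largest distance is the length of an
    actual shortest walk. Only the values of [v] up to the diameter are meaningful. *)
Lemma diametral_path (G : sgraph) : (diameter G < #|G|)%N ->
  exists v : nat -> G,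
    (forall k, (k < diameter G)%N -> adj (v k) (v k.+1)) /\
    (forall q, path (@adj G) (v 0%N) q -> last (v 0%N) q = v (diameter G) ->
       (diameter G <= size q)%N).
Proof.
move=> dG; have G0 : (0 < #|G|)%N by apply: leq_ltn_trans dG.
have [x xE] := bigop.eq_bigmax (fun x : G => \max_(y : G) dist x y)%N G0.
have [y yE] := bigop.eq_bigmax (fun y : G => dist x y) G0.
move: dG; rewrite {1 2 3 4}/diameter xE yE => dG.
have [dmin] := bigminnP (index_enum 'I_#|G|) (fun k : 'I__ => walk_of_length k x y) id #|G|.
rewrite -/(dist x y) => -[dE|[k /existsP[p /andP[px /eqP py]] kE]].
  by rewrite dE ltnn in dG.
rewrite kE; exists (nth x (x :: p)).
have lastE : nth x (x :: p) k = y by rewrite -py (last_nth x) size_tuple.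
split=> [l lk | q xq]; first by have /pathP := px; apply; rewrite size_tuple.
rewrite lastE /= => qy; rewrite leqNgt; apply/negP => qk.
(* A shorter walk has length below [#|G|], hence lies in the range of the minimum defining
   [dist]. *)
have qG : (size q < #|G|)%N by apply: ltn_trans qk (ltn_ord k).
have := dmin (Ordinal qG) (mem_index_enum _); rewrite -/(dist x y) kE /= => H.
suff /H : walk_of_length (size q) x y by lia.
by apply/existsP; exists (in_tuple q); rewrite xq qy eqxx.
Qed.

Section Geodesic.
Variables (G : sgraph) (d : nat) (v : nat -> G).
Hypothesis v_adj : forall k, (k < d)%N -> adj (v k) (v k.+1).
Hypothesis v_min : forall q, path (@adj G) (v 0%N) q -> last (v 0%N) q = v d ->
  (d <= size q)%N.

Lemma segment_path a m : (a + m <= d)%N ->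
  path (@adj G) (v a) [seq v k | k <- iota a.+1 m] /\
  last (v a) [seq v k | k <- iota a.+1 m] = v (a + m)%N.
Proof.
elim: m a => [|m IHm] a am /=; first by rewrite addn0.
rewrite v_adj /=; last by lia.
by rewrite addnS -addSn; apply: IHm; lia.
Qed.

(** Replacing the segment from [v a] to [v b] by [q] gives a walk from [v 0] to [v d] of length a +
    |q| + (d - b), which is at least d. *)
Lemma geodesic_le a b q : (a <= b <= d)%N ->
  path (@adj G) (v a) q -> last (v a) q = v b -> (b - a <= size q)%N.
Proof.
move=> /andP[ab bd] aq qb.
have [|p0 l0] := @segment_path 0 a; first by lia.
have [|p1 l1] := @segment_path b (d - b); first by lia.
have := v_min (q := [seq v k | k <- iota 1 a] ++ q ++ [seq v k | k <- iota b.+1 (d - b)]).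
rewrite !cat_path !last_cat l0 add0n qb l1 p0 aq p1 subnKC // !size_cat !size_map !size_iota.
by move=> /(_ isT erefl); lia.
Qed.

Lemma geodesic_neq a b : (a < b <= d)%N -> v a != v b.
Proof.
move=> abd; apply/eqP => vab.
have := @geodesic_le a b [::]; rewrite vab /= => H.
by have := H _ isT erefl; lia.
Qed.

Lemma geodesic_inj a b : (a <= d)%N -> (b <= d)%N -> v a = v b -> a = b.
Proof.
move=> ad bd vab; case: (ltngtP a b) => // ab.
  by have := @geodesic_neq a b; rewrite ab bd vab eqxx => /(_ isT).
by have := @geodesic_neq b a; rewrite ab ad vab eqxx => /(_ isT).
Qed.

Lemma geodesic_adj a b : (a <= d)%N -> (b <= d)%N ->
  adj (v a) (v b) = (b == a.+1) || (a == b.+1).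
Proof.
wlog ab : a b / (a <= b)%N.
  move=> H ad bd; case: (leqP a b) => ab; first exact: H.
  by rewrite adj_sym orbC; apply: H => //; lia.
move=> ad bd; apply/idP/idP => [vab | /orP[/eqP bE|/eqP aE]]; last by lia.
  have : (b - a <= 1)%N by apply: (@geodesic_le a b [:: v b]); rewrite /= ?vab ?ab.
  case: (eqVneq a b) => [aE|]; last by lia.
  by move: vab; rewrite aE adj_irrefl.
by rewrite bE v_adj //; lia.
Qed.

Lemma geodesic_common_neighbour a b w : (a <= b <= d)%N ->
  adj (v a) w -> adj (v b) w -> (b <= a + 2)%N.
Proof.
move=> abd aw bw; suff : (b - a <= 2)%N by lia.
by apply: (@geodesic_le a b [:: w; v b]); rewrite //= aw adj_sym bw.
Qed.

End Geodesic.

(** * Structure of the unicyclic graphs with one vertex off a diametral path *)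

Lemma triangle_is_cycle (G : sgraph) (x y z : G) :
  adj x y -> adj y z -> adj z x -> is_cycle (cycle_edges [:: x; y; z]).
Proof.
move=> xy yz zx; exists [:: x; y; z]; split=> //.
have ne (u t : G) : adj u t -> u != t.
  by move=> ut; apply: contraTneq ut => ->; rewrite adj_irrefl.
by rewrite /ucycle /= xy yz zx !inE negb_or (ne _ _ xy) (ne _ _ yz) eq_sym (ne _ _ zx).
Qed.

Lemma mem_cycle_edge (G : sgraph) (c : seq G) (A : {set G}) x :
  A \in cycle_edges c -> x \in A -> x \in c.
Proof.
case/imsetP=> y yc -> ; rewrite !inE => /orP[]/eqP-> //.
by rewrite mem_next.
Qed.

Lemma unicyclic_eared_path (G : sgraph) (d : nat) :
  unicyclic G -> #|G| = (d + 2)%N -> diameter G = d ->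
  exists i j, (i < j <= d)%N /\ (j <= i + 2)%N /\ isomorphic G (eared_path d i j).
Proof.
move=> [_ [A0 [[c [c_size c_cyc _]] A0_uniq]]] cardG diamG.
have [|v []] := @diametral_path G; first by rewrite cardG diamG; lia.
rewrite diamG => v_adj v_min.
have v_inj := geodesic_inj v_adj v_min.
have v_adjE := geodesic_adj v_adj v_min.
have v_common := geodesic_common_neighbour v_adj v_min.
pose S := [set v k | k : 'I_d.+1].
have cardS : #|S| = d.+1.
  rewrite card_imset ?card_ord // => k l /v_inj kl.
  by apply: val_inj; apply: kl; rewrite -ltnS ltn_ord.
have /cards1P[w wE] : #|~: S| == 1%N.
  by have := cardsC S; rewrite cardS cardG => ?; lia.
have wN k : (k <= d)%N -> v k != w.
  move=> kd; have : w \in ~: S by rewrite wE inE.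
  rewrite inE; apply: contraNneq => <-.
  by apply/imsetP; exists (Ordinal (kd : k < d.+1)%N).
have vP x : x != w -> exists2 k, (k <= d)%N & x = v k.
  move=> xw; have : x \notin ~: S by rewrite wE inE.
  by rewrite inE negbK => /imsetP[k _ ->]; exists k; rewrite // -ltnS.
have nbrP x : adj w x -> exists2 k, (k <= d)%N & x = v k.
  by move=> wx; apply: vP; apply: contraTneq wx => ->; rewrite adj_irrefl.
have wc : w \in c.
  (* otherwise the vertex of least index of the cycle has only one neighbour in it *)
  apply/negPn/negP => wc.
  have cP x : x \in c -> exists2 k, (k <= d)%N & x = v k.
    by move=> xc; apply: vP; apply: contraNneq wc => <-.
  have ex : exists k, (k <= d)%N && (v k \in c).
    case: c c_size cP {c_cyc wc} => // x c _ cP.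
    by have [|k kd xE] := cP x; [exact: mem_head | exists k; rewrite kd -xE mem_head].
  have [k /andP[kd kc] kmin] := ex_minnP ex.
  have [y [z [yc zc yz ky kz]]] := cycle_two_neighbours c_size c_cyc kc.
  have [a ad yE] := cP _ yc; have [b bd zE] := cP _ zc.
  have ka : (k <= a)%N by apply: kmin; rewrite ad -yE.
  have kb : (k <= b)%N by apply: kmin; rewrite bd -zE.
  move: ky kz yz; rewrite yE zE !v_adjE // => Ha Hb.
  have -> : a = b by lia.
  by rewrite eqxx.
have [i [j [ij jd iw jw]]] : exists i j, [/\ (i < j)%N, (j <= d)%N, adj (v i) w & adj (v j) w].
  have [y [z [_ _ yz wy wz]]] := cycle_two_neighbours c_size c_cyc wc.
  have [a ad yE] := nbrP _ wy; have [b bd zE] := nbrP _ wz.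
  move: wy wz yz; rewrite yE zE => aw bw.
  rewrite adj_sym in aw; rewrite adj_sym in bw.
  case: (ltngtP a b) => [ab|ba|->] ab'; last by rewrite eqxx in ab'.
    by exists a, b.
  by exists b, a.
(* Three consecutive neighbours of w on the path would give two triangles; they are different
   cycles, since [v a] lies only on the first. *)
have no_three a : (a + 2 <= d)%N -> adj (v a) w -> adj (v a.+1) w -> adj (v a.+2) w -> False.
  move=> ad w0 w1 w2.
  have a01 : adj (v a) (v a.+1) by apply: v_adj; lia.
  have a12 : adj (v a.+1) (v a.+2) by apply: v_adj; lia.
  have cyc1 : is_cycle (cycle_edges [:: w; v a; v a.+1]).
    by apply: triangle_is_cycle => //; rewrite adj_sym.
  have cyc2 : is_cycle (cycle_edges [:: w; v a.+1; v a.+2]).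
    by apply: triangle_is_cycle => //; rewrite adj_sym.
  have : [set w; v a] \in cycle_edges [:: w; v a; v a.+1].
    by apply/imsetP; exists w; rewrite ?mem_head //= eqxx.
  rewrite -(A0_uniq _ cyc1) (A0_uniq _ cyc2) => /mem_cycle_edge/(_ (set22 _ _)).
  rewrite !inE (negPf (wN _ _)) /=; last by lia.
  by case/orP=> /eqP/v_inj H; have := H _ _; lia.
have i2 : (j <= i + 2)%N by apply: v_common iw jw; lia.
(* A third neighbour k would lie within distance two of i and j, so i, j, k would be consecutive;
   the three cases are their possible orders. *)
have wadj k : (k <= d)%N -> adj (v k) w = (k == i) || (k == j).
  move=> kd; apply/idP/idP => [kw|/orP[]/eqP-> //].
  apply/negPn/negP; rewrite negb_or => /andP[/eqP ki /eqP kj].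
  case: (ltnP k i) => ki'.
    have ? : (j <= k + 2)%N by apply: v_common kw jw; lia.
    apply: (no_three k) => //; first by lia.
      by have -> : k.+1 = i by lia.
    by have -> : k.+2 = j by lia.
  case: (ltnP k j) => kj'.
    apply: (no_three i) => //; first by lia.
      by have -> : i.+1 = k by lia.
    by have -> : i.+2 = j by lia.
  have ? : (k <= i + 2)%N by apply: v_common iw kw; lia.
  apply: (no_three i) => //; first by lia.
    by have -> : i.+1 = j by lia.
  by have -> : i.+2 = k by lia.
exists i, j; split; first by rewrite ij.
split=> //; apply: isomorphic_sym.
(* The isomorphism is built from the eared path to G, where equal cardinalities reduce bijectivity
   to injectivity. *)
pose f (k : 'I_(d + 2)) := if (k <= d)%N then v k else w.
exists f; split.
  apply: inj_card_bij; last by rewrite cardG card_ord.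
  move=> k l; rewrite /f; have := ltn_ord k; have := ltn_ord l.
  case: (leqP k d) => kd; case: (leqP l d) => ld l2 k2.
  - by move/v_inj => H; apply: val_inj; exact: H.
  - by move/eqP; rewrite (negPf (wN _ kd)).
  - by move/esym/eqP; rewrite (negPf (wN _ ld)).
  - by move=> _; apply: val_inj => /=; lia.
move=> k l; rewrite /f /= /ear_adj /ear_arc; have := ltn_ord k; have := ltn_ord l.
case: (leqP k d) => kd; case: (leqP l d) => ld l2 k2.
- by rewrite v_adjE //; lia.
- by rewrite wadj //; lia.
- by rewrite adj_sym wadj //; lia.
- by rewrite adj_irrefl; lia.
Qed.

(** * Reversal of the path, and the extremal graph *)

(** The map k to d - k reflects the path and fixes w = d + 1. It brings an arm of length one on the
    right to the left. *)
Lemma eared_path_rev (d i j : nat) : (i <= d)%N -> (j <= d)%N ->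
  isomorphic (eared_path d i j) (eared_path d (d - j) (d - i)).
Proof.
move=> id jd.
have rev_lt (k : 'I_(d + 2)) : ((if k <= d then d - k else k) < d + 2)%N.
  by have := ltn_ord k; case: ifP; lia.
pose f k := Ordinal (rev_lt k).
have fK : involutive f.
  move=> k; apply: val_inj => /=; have := ltn_ord k.
  case: (leqP k d) => kd k2; first by rewrite leq_subr subKn.
  by rewrite leqNgt kd.
exists f; split; first by exists f.
have top (k : 'I_(d + 2)) : (d < k)%N -> k = d.+1 :> nat by have := ltn_ord k; lia.
move=> k l; rewrite /= /ear_adj /=.
case: (leqP k d) => [kd | /top ->]; case: (leqP l d) => [ld | /top ->].
- by rewrite !ear_arc_path ?leq_subr //; lia.
- by rewrite !ear_arc_ear ?leq_subr // !ear_arc_path ?leq_subr //; lia.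
- by rewrite !ear_arc_ear ?leq_subr // !ear_arc_path ?leq_subr //; lia.
- by rewrite /ear_arc !ltnn.
Qed.

(* In [U (d + 2) d] the pendant neighbour of v_1 is the last index, whereas the
   diametral path of [eared_path] starts with it: the two labellings differ by
   the cyclic shift [ordS]. *)
Lemma U_eared_path (d : nat) : (4 <= d)%N -> isomorphic (U (d + 2) d) (eared_path d 1 3).
Proof.
move=> d4; exists (@ordS (d + 2)); split; first exact: ordS_bij.
have U_arc_path a b : (b < d)%N -> U_arc d a b = (b == a.+1).
  by move=> bd; rewrite /U_arc; lia.
have U_arc_ear a : U_arc d a d = (a == 0) || (a == 2).
  by rewrite /U_arc; lia.
have U_arc_pendant a : U_arc d a d.+1 = (a == 0).
  by rewrite /U_arc; lia.
have shift_le n : (n <= d)%N -> (n.+1 %% (d + 2) = n.+1)%N.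
  by move=> nd; rewrite modn_small //; lia.
have shift_top : (d.+2 %% (d + 2) = 0)%N by rewrite addn2 modnn.
have cases (k : 'I_(d + 2)) : [\/ (k < d)%N, k = d :> nat | k = d.+1 :> nat].
  have := ltn_ord k; case: (ltngtP k d) => kd k2.
  - by constructor 1.
  - by constructor 3; lia.
  - by constructor 2.
move=> k l; rewrite /= /ear_adj /U_adj /=.
case: (cases k) => [kd | -> | ->]; case: (cases l) => [ld | -> | ->];
  rewrite ?shift_top ?(shift_le d) ?(shift_le k (ltnW kd)) ?(shift_le l (ltnW ld)) //.
all: rewrite ?(U_arc_path _ _ kd) ?(U_arc_path _ _ ld) ?U_arc_ear ?U_arc_pendant.
all: rewrite ?ear_arc_ear ?ear_arc_path //; lia.
Qed.

(** * The upper bound and its equality case *)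

Theorem theorem2 (R : realType) (alpha : R) (d : nat) (G : sgraph)
    (alpha_gt0 : 0 < alpha) (alpha_lt1 : alpha < 1) (d_ge4 : (4 <= d)%N)
    (G_unicyclic : unicyclic G) (G_order : #|G| = (d + 2)%N)
    (G_diameter : diameter G = d) :
  sombor alpha G <= sombor alpha (U (d + 2) d) /\
  (sombor alpha G = sombor alpha (U (d + 2) d) <-> isomorphic G (U (d + 2) d)).
Proof.
(* Both claims follow from this dichotomy, as isomorphic graphs have equal index and a strict
   inequality excludes isomorphism. *)
suff [lt_GU | GU] : sombor alpha G < sombor alpha (U (d + 2) d) \/
    isomorphic G (U (d + 2) d).
- split; first exact: ltW.
  by split=> [eq_GU | /(sombor_isomorphic alpha)//]; rewrite eq_GU ltxx in lt_GU.
- by have eq_GU := sombor_isomorphic alpha GU; split; rewrite eq_GU.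
have U_iso := U_eared_path d_ge4.
have [i [j [ijd [ji2 G_iso]]]] := unicyclic_eared_path G_unicyclic G_order G_diameter.
rewrite (sombor_isomorphic alpha G_iso) (sombor_isomorphic alpha U_iso).
have [jE | jE] : j = (i + 1)%N \/ j = (i + 2)%N by lia.
  left; have := sombor_triangle_lt alpha_gt0 alpha_lt1 (a := i) (b := d - j).
  have -> : (i + (d - j) + 1 = d)%N by lia.
  have -> : (1 + (i + (d - j) - 2) + 2 = d)%N by lia.
  by rewrite -jE; apply; lia.
case: (eqVneq i 1%N) => [iE | i_neq1].
  right; apply: isomorphic_trans (isomorphic_sym U_iso).
  by move: G_iso; rewrite jE iE.
case: (eqVneq (d - j)%N 1%N) => [djE | dj_neq1].
  right; apply: isomorphic_trans (isomorphic_sym U_iso).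
  apply: isomorphic_trans G_iso _.
  (* Here i = d - 3 and j = d - 1, so the reversal carries the attachment pair to 1 and 3. *)
  have diE : (d - i = 3)%N by lia.
  by rewrite -diE -[1%N]djE; apply: eared_path_rev; lia.
left; have := sombor_square_lt alpha_gt0 alpha_lt1 (a := i) (b := d - j) _ i_neq1 dj_neq1.
have -> : (i + (d - j) + 2 = d)%N by lia.
have -> : (1 + (i + (d - j) - 1) + 2 = d)%N by lia.
by rewrite -jE; apply; lia.
Qed.
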